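(* Let $((\mathbf{u},p),(\boldsymbol{\phi},r),\mathbf{y})\in V\times V\times Q_{ad}$ solve the continuous optimality system and let $((\mathbf{u}_h,p_h),(\boldsymbol{\phi}_h,r_h),\mathbf{y}_h)\in V_h\times V_h\times Q_{ad}^h$ solve the discrete optimality system (both written out in the context). Let $P_h\mathbf{u},\bar P_h\boldsymbol{\phi}\in X_h$ be the projections defined in the context. Then there is a constant $C>0$, independent of the mesh-size, such that $$\|\boldsymbol\phi-\boldsymbol\phi_h\|_h\le C\big(\|\boldsymbol\phi-\bar P_h\boldsymbol\phi\|_h+\|E\boldsymbol\phi-\Pi_h(E\boldsymbol\phi)\|_Q+\|\mathbf y-\Pi_h\mathbf y\|_Q+\|\mathbf u-P_h\mathbf u\|_W\big)$$ and $$\|\mathbf u-\mathbf u_h\|_h\le C\big(\|\mathbf u-P_h\mathbf u\|_h+\|\boldsymbol\phi-\bar P_h\boldsymbol\phi\|_h+\|E\boldsymbol\phi-\Pi_h(E\boldsymbol\phi)\|_Q+\|\mathbf y-\Pi_h\mathbf y\|_Q\big).$$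
   Context: All vector spaces are real. Continuous setting. $X,M,W,Q$ are Hilbert spaces, $V=X\times M$, with $X\subset W\subset X'$ with continuous inclusions ($X'$ the dual of $X$). $E:X\to Q$ is continuous and linear; $Q_{ad}\subset Q$ is nonempty, closed and convex. $\mathbf f,\mathbf u_d\in W$ and $\lambda>0$ are given. $a:X\times X\to\mathbb R$, $b:X\times M\to\mathbb R$ are continuous bilinear forms with $|a(\mathbf v,\mathbf z)|\le C_1\|\mathbf v\|_X\|\mathbf z\|_X$ and $|b(\mathbf z,p)|\le C_2\|\mathbf z\|_X\|p\|_M$; with $Z=\{\mathbf v\in X: b(\mathbf v,w)=0\ \forall w\in M\}$, $a$ is $Z$-elliptic: $\alpha\|\mathbf v\|_X^2\le a(\mathbf v,\mathbf v)$ for all $\mathbf v\in Z$, $\alpha>0$; and $b$ satisfies the inf-sup condition $\inf_{p\in M}\sup_{\mathbf z\in X} b(\mathbf z,p)/(\|\mathbf z\|_X\|p\|_M)\ge\beta>0$. Continuous optimality system for $((\mathbf u,p),(\boldsymbol\phi,r),\mathbf y)\in V\times V\times Q_{ad}$: for all $\mathbf z\in X$, $w\in M$, $\mathbf x\in Q_{ad}$, $a(\mathbf u,\mathbf z)+b(\mathbf z,p)=\langle\mathbf y,E\mathbf z\rangle_Q+\langle\mathbf f,\mathbf z\rangle_W$, $b(\mathbf u,w)=0$, $a(\mathbf z,\boldsymbol\phi)-b(\mathbf z,r)=\langle\mathbf u-\mathbf u_d,\mathbf z\rangle_W$, $b(\boldsymbol\phi,w)=0$, $\langle E\boldsymbol\phi+\lambda\mathbf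 y,\mathbf x-\mathbf y\rangle_Q\ge0$. Discrete setting. $X_h\subset W$ is a finite dimensional subspace, $\|\cdot\|_h$ is a norm on $X+X_h$ with $\|\mathbf v\|_h=\|\mathbf v\|_X$ for $\mathbf v\in X$; $M_h\subset M$ is a finite dimensional subspace with norm $\|\cdot\|_M$; $V_h=X_h\times M_h$; $Q_h\subseteq Q$ is a finite dimensional subspace and $Q_{ad}^h\subset Q_{ad}$ is a nonempty closed convex subset of $Q_h$. $a_h:X_h\times X_h\to\mathbb R$, $b_h:X_h\times M_h\to\mathbb R$ are bilinear with $|a_h(\mathbf v_h,\mathbf z_h)|\le\bar C_1\|\mathbf v_h\|_h\|\mathbf z_h\|_h$, $|b_h(\mathbf z_h,p_h)|\le\bar C_2\|\mathbf z_h\|_h\|p_h\|_M$; with $Z_h=\{\mathbf v_h\in X_h:b_h(\mathbf v_h,w_h)=0\ \forall w_h\in M_h\}$, $\bar\alpha\|\mathbf v_h\|_h^2\le a_h(\mathbf v_h,\mathbf v_h)$ on $Z_h$, $\bar\alpha>0$; and $\inf_{p_h\in M_h}\sup_{\mathbf z_h\in X_h}b_h(\mathbf z_h,p_h)/(\|\mathbf z_h\|_h\|p_h\|_M)\ge\bar C>0$. $E_h:X_h+X\to Q$ is linear with $E_h\mathbf v=E\mathbf v$ for $\mathbf v\in X$. Discrete optimality system for $((\mathbf u_h,p_h),(\boldsymbol\phi_h,r_h),\mathbf y_h)\in V_h\times V_h\times Q_{ad}^h$: for all $\mathbf z_h\in X_h$, $w_h\in M_h$, $\mathbf x_h\in Q_{ad}^h$,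 $a_h(\mathbf u_h,\mathbf z_h)+b_h(\mathbf z_h,p_h)=\langle\mathbf y_h,E_h\mathbf z_h\rangle_Q+\langle\mathbf f,\mathbf z_h\rangle_W$, $b_h(\mathbf u_h,w_h)=0$, $a_h(\mathbf z_h,\boldsymbol\phi_h)-b_h(\mathbf z_h,r_h)=\langle\mathbf u_h-\mathbf u_d,\mathbf z_h\rangle_W$, $b_h(\boldsymbol\phi_h,w_h)=0$, $\langle E_h\boldsymbol\phi_h+\lambda\mathbf y_h,\mathbf x_h-\mathbf y_h\rangle_Q\ge0$. Standing assumptions. (I) $\|\mathbf v\|_W\le C_W\|\mathbf v\|_h$ for all $\mathbf v\in X+X_h$. (II) $\|E_h(\mathbf v-\mathbf v_h)\|_Q\le\|\mathbf v-\mathbf v_h\|_h$ for all $\mathbf v\in X,\mathbf v_h\in X_h$. (III) $\Pi_h:Q\to Q_h$ is the $Q$-orthogonal projection, and $\Pi_h\mathbf x\in Q_{ad}^h$ whenever $\mathbf x\in Q_{ad}$. Projections. $(P_h\mathbf u,R_hp),(\bar P_h\boldsymbol\phi,\bar R_hr)\in X_h\times M_h$ are the unique solutions of: for all $\mathbf z_h\in X_h$, $w_h\in M_h$, $a_h(P_h\mathbf u,\mathbf z_h)+b_h(\mathbf z_h,R_hp)=\langle\mathbf y,E_h\mathbf z_h\rangle_Q+\langle\mathbf f,\mathbf z_h\rangle_W$, $b_h(P_h\mathbf u,w_h)=0$, $a_h(\mathbf z_h,\bar P_h\boldsymbol\phi)-b_h(\mathbf z_h,\bar R_hr)=\langle\mathbf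 u-\mathbf u_d,\mathbf z_h\rangle_W$, $b_h(\bar P_h\boldsymbol\phi,w_h)=0$. ''Independent of the mesh-size'' means: depending only on $\lambda$ and on the constants $C_1,C_2,\alpha,\beta,\bar C_1,\bar C_2,\bar\alpha,\bar C,C_W$. *)

(* Defs.v *)
From HB Require Import structures.
From mathcomp Require Import all_boot all_order all_algebra.
From mathcomp Require Import sesquilinear.
From mathcomp Require Import boolp classical_sets reals ereal topology.
From mathcomp Require Import normedtype convex.

Set Implicit Arguments.
Unset Strict Implicit.
Unset Printing Implicit Defensive.

Import Order.TTheory GRing.Theory Num.Theory.
Import numFieldNormedType.Exports.

Local Open Scope classical_set_scope.
Local Open Scope ring_scope.

(* Real Hilbert spaces: complete normed spaces over R whose norm is induced by
   an inner product. *)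
HB.mixin Record NormedModule_isInnerProduct (R : realType) V
    of NormedModule R V := {
  inner : {dot V for (@idfun R)} ;
  inner_normE : forall x : V, inner x x = `|x| ^+ 2
}.

#[short(type="hilbertType")]
HB.structure Definition Hilbert (R : realType) :=
  {V of CompleteNormedModule R V & NormedModule_isInnerProduct R V}.

Arguments inner {R s}.

Notation "''[' x , y ]" := (inner x y) : ring_scope.

Section LinearAlgebra.
Variable R : realType.
Implicit Types U V W : lmodType R.

(* Finite dimensional linear subspaces of a possibly infinite dimensional
   space: the linear spans of finite families. *)
Definition fin_dim_subspace V (S : set V) : Prop :=
  exists n (e : 'I_n -> V),
    S = [set v | exists c : 'I_n -> R, v = \sum_(i < n) c i *: e i].

(* Maps and norms defined only on a subspace S are represented by total
   functions constrained on S; their values outside S are irrelevant. *)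
Definition linear_on U V (S : set U) (f : U -> V) : Prop :=
  forall (c : R) x y, S x -> S y -> f (c *: x + y) = c *: f x + f y.

Definition bilinear_on U V (S : set U) (T : set V) (b : U -> V -> R) : Prop :=
  (forall y, T y -> linear_on S (fun x => b x y : R^o)) /\
  (forall x, S x -> linear_on T (fun y => b x y : R^o)).

Definition norm_on V (S : set V) (N : V -> R) : Prop :=
  [/\ forall x, S x -> 0 <= N x,
      forall x, S x -> N x = 0 -> x = 0,
      forall (c : R) x, S x -> N (c *: x) = `|c| * N x &
      forall x y, S x -> S y -> N (x + y) <= N x + N y].

Definition bounded_form U V (S : set U) (NS : U -> R) (T : set V) (NT : V -> R)
    (b : U -> V -> R) (C : R) : Prop :=
  forall x y, S x -> T y -> `|b x y| <= C * NS x * NT y.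

Definition form_kernel U V (S : set U) (T : set V) (b : U -> V -> R) : set U :=
  [set x | S x /\ forall y, T y -> b x y = 0].

Definition elliptic_on U (Z : set U) (N : U -> R) (a : U -> U -> R) (c : R) :
    Prop :=
  forall x, Z x -> c * N x ^+ 2 <= a x x.

(* inf over nonzero y in T of the sup over nonzero x in S of
   b x y / (NS x * NT y), in the extended reals. *)
Definition inf_sup U V (S : set U) (NS : U -> R) (T : set V) (NT : V -> R)
    (b : U -> V -> R) : \bar R :=
  ereal_inf [set ereal_sup [set (b x y / (NS x * NT y))%:E | x in S `\ 0]
            | y in T `\ 0].

End LinearAlgebra.

Section Hilbert.
Variable R : realType.

(* X \subset W \subset X': the embedding i is the inclusion of X in W, and
   w |-> '[w, i -] is the inclusion of W in the dual X' of X. The last clause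
   is the continuity of the latter for the operator norm of X'. *)
Definition gelfand_triple (X W : hilbertType R) (i : {linear X -> W}) : Prop :=
  [/\ injective i, continuous i,
      injective (fun (w : W) (v : X) => '[w, i v]) &
      exists K : R, forall (w : W) (v : X),
        `|'[w, i v]| <= K * `|w| * `|v|].

Definition sum_space (X W : hilbertType R) (i : X -> W) (Xh : set W) : set W :=
  [set i v + vh | v in [set: X] & vh in Xh].

Definition orthogonal_projection (Q : hilbertType R) (S : set Q)
    (Pi : Q -> Q) : Prop :=
  forall x, S (Pi x) /\ forall s, S s -> '[x - Pi x, s] = 0.

End Hilbert.

(* Main.v *)
Require Import Defs.
From mathcomp Require Import all_boot all_order all_algebra.
From mathcomp Require Import sesquilinear.
From mathcomp Require Import boolp classical_sets reals ereal topology.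
From mathcomp Require Import normedtype convex.
From mathcomp Require Import ring lra.

Set Implicit Arguments.
Unset Strict Implicit.
Unset Printing Implicit Defensive.

Import Order.TTheory GRing.Theory Num.Theory.
Import numFieldNormedType.Exports.

Local Open Scope classical_set_scope.
Local Open Scope ring_scope.

(* Put d = P_h u - u_h and e = Pbar_h phi - phi_h, both in Z_h. Testing the
   difference of the state equations with e and that of the adjoint equations
   with d gives <y - y_h, E_h e>_Q = a_h(d, e) = <u - u_h, d>_W, which is
   |u - u_h|_W^2 up to |u - u_h|_W |u - P_h u|_W. Adding the two variational
   inequalities bounds lambda |y - y_h|^2 + <y - y_h, E_h e>_Q by products of
   errors and projection errors, so |y - y_h|_Q and |u - u_h|_W are both
   controlled by the projection errors. Ellipticity on Z_h then bounds d by
   |y - y_h|_Q and e by |u - u_h|_W. *)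

Section InnerProduct.
Variables (R : realType) (V : hilbertType R).
Implicit Types x y z : V.

Lemma innerC x y : '[x, y] = '[y, x].
Proof. by rewrite hermC expr0 mul1r. Qed.

Lemma innerZl (c : R) x y : '[c *: x, y] = c * '[x, y].
Proof. exact: linearZl_LR. Qed.

Lemma innerZr (c : R) x y : '[x, c *: y] = c * '[x, y].
Proof. by rewrite innerC innerZl innerC. Qed.

Lemma innerDl x y z : '[x + y, z] = '[x, z] + '[y, z].
Proof. exact: linearDl. Qed.

Lemma innerNl x y : '[- x, y] = - '[x, y].
Proof. exact: linearNl. Qed.

Lemma innerDr x y z : '[x, y + z] = '[x, y] + '[x, z].
Proof. exact: linearDr. Qed.

Lemma innerNr x y : '[x, - y] = - '[x, y].
Proof. exact: linearNr. Qed.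

Definition innerE := (innerDl, innerNl, innerDr, innerNr, innerZl, innerZr).

(** Cauchy-Schwarz: for nonzero vectors the squared norm of [|y| x - |x| y] is [2 |x| |y| (|x| |y| -
    '[x, y])], and the positive factor divides out. *)
Lemma inner_le_norm x y : '[x, y] <= `|x| * `|y|.
Proof.
have [->|x0] := eqVneq x 0; first by rewrite linear0l normr0 mul0r.
have [->|y0] := eqVneq y 0; first by rewrite linear0r normr0 mulr0.
have xy_gt0 : 0 < `|x| * `|y| by rewrite mulr_gt0 ?normr_gt0.
have : 0 <= '[`|y| *: x - `|x| *: y, `|y| *: x - `|x| *: y].
  by rewrite inner_normE sqr_ge0.
rewrite !innerE !inner_normE (innerC y x) => h.
rewrite -subr_ge0 -(pmulr_rge0 _ xy_gt0); nra.
Qed.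

End InnerProduct.

Section LinearOn.
Variable R : realType.

Lemma fin_dim_subspace0 (V : lmodType R) (S : set V) :
  fin_dim_subspace S -> S 0.
Proof.
move=> [n [e ->]]; exists (fun=> 0).
by rewrite big1 // => k _; rewrite scale0r.
Qed.

Lemma fin_dim_subspaceP (V : lmodType R) (S : set V) (c : R) x y :
  fin_dim_subspace S -> S x -> S y -> S (c *: x + y).
Proof.
move=> [n [e ->]] [k ->] [l ->]; exists (fun j => c * k j + l j).
rewrite scaler_sumr -big_split; apply: eq_bigr => j _ /=.
by rewrite scalerDl scalerA.
Qed.

Lemma fin_dim_subspaceB (V : lmodType R) (S : set V) x y :
  fin_dim_subspace S -> S x -> S y -> S (x - y).
Proof.
by move=> fS Sx Sy; rewrite addrC -scaleN1r; exact: fin_dim_subspaceP.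
Qed.

Lemma linear_onB (U V : lmodType R) (S : set U) (f : U -> V) x y :
  linear_on S f -> S x -> S y -> f (x - y) = f x - f y.
Proof.
by move=> lf Sx Sy; rewrite addrC -scaleN1r lf // scaleN1r addrC.
Qed.

Lemma bilinear_onBl (U V : lmodType R) (S : set U) (T : set V) b x x' y :
  bilinear_on S T b -> S x -> S x' -> T y -> b (x - x') y = b x y - b x' y.
Proof.
by move=> [lb _] Sx Sx' Ty; exact: (linear_onB (lb y Ty) Sx Sx').
Qed.

Lemma bilinear_onBr (U V : lmodType R) (S : set U) (T : set V) b x y y' :
  bilinear_on S T b -> S x -> T y -> T y' -> b x (y - y') = b x y - b x y'.
Proof.
by move=> [_ lb] Sx Ty Ty'; exact: (linear_onB (lb x Sx) Ty Ty').
Qed.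

End LinearOn.

(* The two variational inequalities are added, the continuous one tested with
   [yh], the discrete one with [Pi y]. The pairing with the adjoint error [e]
   stays on the left: by duality it is [|u - uh|^2] up to a projection error. *)
Lemma control_error (R : realType) (Q : hilbertType R) (S : set Q)
    (Pi : Q -> Q) (lambda : R) (y yh g gb e : Q) :
  orthogonal_projection S Pi -> S yh ->
  0 <= '[g + lambda *: y, yh - y] ->
  0 <= '[(gb - e) + lambda *: yh, Pi y - yh] ->
  lambda * `|y - yh| ^+ 2 + '[y - yh, e] <=
    `|g - gb| * `|y - yh| + (`|g - gb| + `|e| + `|g - Pi g|) * `|y - Pi y|.
Proof.
move=> oPi Syh vi vih.
(* [y - Pi y] is orthogonal to [yh], which turns the [lambda] terms into [- lambda |y - yh|^2], and
   to [Pi g], which replaces [g] by [g - Pi g] in its pairing with [Pi y - y]. *)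
have [SPiy /(_ _ Syh) o1] := oPi y.
have /(_ _ (oPi g).1) o2 := (oPi y).2.
have c1 := inner_le_norm (g - gb) (yh - y).
have c2 := inner_le_norm (g - gb) (y - Pi y).
have c3 := inner_le_norm e (y - Pi y).
have c4 := inner_le_norm (g - Pi g) (Pi y - y).
rewrite (distrC yh) in c1; rewrite (distrC _ y) in c4.
rewrite !mulrDl -inner_normE.
apply: le_trans (lerD c1 (lerD (lerD c2 c3) c4)).
have o1' : lambda * '[y - Pi y, yh] = 0 by rewrite o1 mulr0.
move: vi vih o1' o2; rewrite !innerE.
rewrite !(innerC _ y) !(innerC _ yh) !(innerC _ (Pi y)).
rewrite !(innerC _ (Pi g)); lra.
Qed.

Section ScalarBounds.
Variable R : realFieldType.

(** If the bound failed, the summand 1 would give [T < s], hence [k T^2 <= k T s], while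
    [(q + k) / mu * T < s] gives [(q + k) T s < mu s^2]: a contradiction, with no square roots. *)
Lemma ler_quadratic (mu q k T s : R) :
  0 < mu -> 0 <= q -> 0 <= k -> 0 <= T -> 0 <= s ->
  mu * s ^+ 2 <= q * T * s + k * T ^+ 2 -> s <= ((q + k) / mu + 1) * T.
Proof.
move=> mu0 q0 k0 T0 s0 h; rewrite leNgt; apply/negP.
set c := (q + k) / mu => sT.
have cE : mu * c = q + k by rewrite /c mulrC divfK ?gt_eqF.
have c0 : 0 <= c by rewrite divr_ge0 ?addr_ge0 ?(ltW mu0).
have Ts : T < s by apply: le_lt_trans sT; rewrite mulrDl mul1r lerDr mulr_ge0.
have s_gt0 : 0 < s by exact: le_lt_trans Ts.
have cTs : c * T < s by apply: le_lt_trans sT; rewrite mulrDl mul1r lerDl.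
have : mu * (c * T * s) < mu * s ^+ 2 by rewrite ltr_pM2l // expr2 ltr_pM2r.
have -> : mu * (c * T * s) = q * T * s + k * (T * s) by rewrite -(mulrA c) (mulrA mu) cE; ring.
have : k * T ^+ 2 <= k * (T * s).
  by rewrite ler_wpM2l // expr2 ler_wpM2l // ltW.
lra.
Qed.

Lemma ler_elliptic (al n m : R) :
  0 < al -> 0 <= n -> 0 <= m -> al * n ^+ 2 <= m * n -> n <= m / al.
Proof.
move=> al0 n0 m0 h; rewrite ler_pdivlMr //.
have [->|n1] := eqVneq n 0; first by rewrite mul0r.
have n_gt0 : 0 < n by rewrite lt_def n1.
by rewrite -(ler_pM2r n_gt0); lra.
Qed.

(** Here [s] and [t] stand for the control error and the state error in [W], [n] for the discrete
    adjoint difference. Once all projection errors are majorized by their sum [T], either unknown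
    can be eliminated, leaving a quadratic inequality in the other. *)
Lemma coupled_bounds (lambda K A B G D s t n : R) :
  0 < lambda -> 0 <= K -> 0 <= A -> 0 <= B -> 0 <= G -> 0 <= D ->
  0 <= s -> 0 <= t -> n <= K * t ->
  lambda * s ^+ 2 + t ^+ 2 <= t * D + (A * s + (A + n + G) * B) ->
  t <= (3 + K + (4 * lambda)^-1) * (A + G + B + D) /\
  s <= ((2 + (1 + K) ^+ 2 / 4) / lambda + 1) * (A + G + B + D).
Proof.
move=> l0 K0 A0 B0 G0 D0 s0 t0 nK h.
set T := A + G + B + D.
have T0 : 0 <= T by rewrite /T !addr_ge0.
have energy : lambda * s ^+ 2 + t ^+ 2 <=
    T * s + (1 + K) * (T * t) + T ^+ 2.
  have e1 : A * s <= T * s by rewrite ler_wpM2r // /T; lra.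
  have e2 : t * D <= T * t by rewrite mulrC ler_wpM2r // /T; lra.
  have e3 : (A + G) * B <= T ^+ 2.
    by rewrite expr2 ler_pM ?addr_ge0 // /T; lra.
  have e4 : n * B <= K * (T * t).
    apply: (@le_trans _ _ (K * t * B)); first by rewrite ler_wpM2r.
    by rewrite -mulrA ler_wpM2l // mulrC ler_wpM2r // /T; lra.
  by move: (T) h e1 e2 e3 e4 => T1; lra.
split.
(* Young's inequality absorbs [T * s] into [lambda * s ^+ 2]; what remains is quadratic in [t]. *)
- have ys : T * s <= lambda * s ^+ 2 + (4 * lambda)^-1 * T ^+ 2.
    have : 0 <= lambda * (s - (2 * lambda)^-1 * T) ^+ 2.
      by rewrite mulr_ge0 ?sqr_ge0 ?(ltW l0).
    suff -> : lambda * (s - (2 * lambda)^-1 * T) ^+ 2 =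
      lambda * s ^+ 2 + (4 * lambda)^-1 * T ^+ 2 - T * s by lra.
    by field; rewrite gt_eqF.
  have -> : 3 + K + (4 * lambda)^-1 =
    ((1 + K) + (1 + (4 * lambda)^-1)) / 1 + 1 by rewrite divr1; ring.
  have l4 : 0 <= (4 * lambda)^-1 by rewrite invr_ge0 mulr_ge0 ?(ltW l0).
  apply: ler_quadratic => //; [lra|lra|].
  by move: (T) (4 * lambda)^-1 energy ys => T1 l1; lra.
- have -> : 2 + (1 + K) ^+ 2 / 4 = 1 + (1 + (1 + K) ^+ 2 / 4) :> R by ring.
  apply: ler_quadratic => //; first by rewrite addr_ge0 ?divr_ge0 ?sqr_ge0.
  (* Symmetrically, [t ^+ 2] absorbs the term linear in [t], at the price of [(1 + K) ^+ 2 / 4]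
     times [T ^+ 2]. *)
  have : 0 <= (t - (1 + K) / 2 * T) ^+ 2 by exact: sqr_ge0.
  have -> : (t - (1 + K) / 2 * T) ^+ 2 =
    t ^+ 2 - (1 + K) * (T * t) + (1 + K) ^+ 2 / 4 * T ^+ 2 by field.
  by move: (T) energy => T1; lra.
Qed.

End ScalarBounds.

(* Both differences lie in the kernel of [bh], so the multipliers disappear
   and testing each equation with the other difference gives [ah d e] twice. *)
Lemma saddle_duality (R : realType) (U M : lmodType R) (S : set U) (T : set M)
    (a : U -> U -> R) (b : U -> M -> R) (F G : U -> R) (d e : U) (p r : M) :
  form_kernel S T b d -> form_kernel S T b e -> T p -> T r ->
  (forall z, S z -> a d z + b z p = F z) ->
  (forall z, S z -> a z e - b z r = G z) ->
  [/\ F e = G d, a d d = F d & a e e = G e].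
Proof.
move=> [Sd kd] [Se ke] Tp Tr Fd Ge.
by split; rewrite -?Fd -?Ge // ?kd ?ke // ?addr0 ?subr0.
Qed.

Theorem theorem2p4 (R : realType)
    (lambda C1 C2 alpha beta Cb1 Cb2 alphab Cb CW : R)
    (lambda_gt0 : 0 < lambda) (alpha_gt0 : 0 < alpha) (beta_gt0 : 0 < beta)
    (alphab_gt0 : 0 < alphab) (Cb_gt0 : 0 < Cb) :
  exists C : R, 0 < C /\
  forall
    (* continuous setting *)
    (X M W Q : hilbertType R) (i : {linear X -> W}) (_ : gelfand_triple i)
    (E : {linear X -> Q}) (_ : continuous E)
    (Qad : set Q) (_ : Qad !=set0) (_ : closed Qad) (_ : convex_set Qad)
    (f ud : W)
    (a : {bilinear X -> X -> R | *%R & *%R})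
    (b : {bilinear X -> M -> R | *%R & *%R})
    (_ : continuous (fun vz : X * X => a vz.1 vz.2))
    (_ : continuous (fun zp : X * M => b zp.1 zp.2))
    (_ : bounded_form [set: X] Num.norm [set: X] Num.norm a C1)
    (_ : bounded_form [set: X] Num.norm [set: M] Num.norm b C2)
    (_ : elliptic_on (form_kernel [set: X] [set: M] b) Num.norm a alpha)
    (_ : (beta%:E <= inf_sup [set: X] Num.norm [set: M] Num.norm b)%E)
    (* discrete setting *)
    (Xh : set W) (_ : fin_dim_subspace Xh)
    (normh : W -> R) (_ : norm_on (sum_space i Xh) normh)
    (_ : forall v : X, normh (i v) = `|v|)
    (Mh : set M) (_ : fin_dim_subspace Mh)
    (Qh : set Q) (_ : fin_dim_subspace Qh)
    (Qadh : set Q) (_ : Qadh `<=` Qad) (_ : Qadh `<=` Qh)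
    (_ : Qadh !=set0) (_ : closed Qadh) (_ : convex_set Qadh)
    (ah : W -> W -> R) (_ : bilinear_on Xh Xh ah)
    (bh : W -> M -> R) (_ : bilinear_on Xh Mh bh)
    (_ : bounded_form Xh normh Xh normh ah Cb1)
    (_ : bounded_form Xh normh Mh Num.norm bh Cb2)
    (_ : elliptic_on (form_kernel Xh Mh bh) normh ah alphab)
    (_ : (Cb%:E <= inf_sup Xh normh Mh Num.norm bh)%E)
    (Eh : W -> Q) (_ : linear_on (sum_space i Xh) Eh)
    (_ : forall v : X, Eh (i v) = E v)
    (* standing assumptions *)
    (_ : forall v, sum_space i Xh v -> `|v| <= CW * normh v)
    (_ : forall (v : X) vh, Xh vh -> `|Eh (i v - vh)| <= normh (i v - vh))
    (Pih : Q -> Q) (_ : orthogonal_projection Qh Pih)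
    (_ : forall x, Qad x -> Qadh (Pih x))
    (* continuous optimality system *)
    (u phi : X) (p r : M) (y : Q) (_ : Qad y)
    (_ : forall z, a u z + b z p = '[y, E z] + '[f, i z])
    (_ : forall w, b u w = 0)
    (_ : forall z, a z phi - b z r = '[i u - ud, i z])
    (_ : forall w, b phi w = 0)
    (_ : forall x, Qad x -> 0 <= '[E phi + lambda *: y, x - y])
    (* discrete optimality system *)
    (uh phih : W) (ph rh : M) (yh : Q)
    (_ : Xh uh) (_ : Xh phih) (_ : Mh ph) (_ : Mh rh) (_ : Qadh yh)
    (_ : forall zh, Xh zh ->
       ah uh zh + bh zh ph = '[yh, Eh zh] + '[f, zh])
    (_ : forall wh, Mh wh -> bh uh wh = 0)
    (_ : forall zh, Xh zh -> ah zh phih - bh zh rh = '[uh - ud, zh])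
    (_ : forall wh, Mh wh -> bh phih wh = 0)
    (_ : forall xh, Qadh xh -> 0 <= '[Eh phih + lambda *: yh, xh - yh])
    (* projections *)
    (Phu Pbhphi : W) (Rhp Rbhr : M)
    (_ : Xh Phu) (_ : Xh Pbhphi) (_ : Mh Rhp) (_ : Mh Rbhr)
    (_ : forall zh, Xh zh ->
       ah Phu zh + bh zh Rhp = '[y, Eh zh] + '[f, zh])
    (_ : forall wh, Mh wh -> bh Phu wh = 0)
    (_ : forall zh, Xh zh -> ah zh Pbhphi - bh zh Rbhr = '[i u - ud, zh])
    (_ : forall wh, Mh wh -> bh Pbhphi wh = 0),
    normh (i phi - phih) <=
      C * (normh (i phi - Pbhphi) + `|E phi - Pih (E phi)|
           + `|y - Pih y| + `|i u - Phu|)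
    /\
    normh (i u - uh) <=
      C * (normh (i u - Phu) + normh (i phi - Pbhphi)
           + `|E phi - Pih (E phi)| + `|y - Pih y|).
Proof.
(* [K] bounds [normh e] by the state error in [W]; [L] and [L'] are the constants of
   [coupled_bounds]. The absolute value is there because [CW] has no prescribed sign. *)
pose K := `|CW| / alphab.
pose L := 3 + K + (4 * lambda)^-1.
pose L' := (2 + (1 + K) ^+ 2 / 4) / lambda + 1.
have K0 : 0 <= K by rewrite divr_ge0 ?(ltW alphab_gt0).
have L0 : 0 <= L.
  by rewrite !addr_ge0 // invr_ge0 mulr_ge0 ?(ltW lambda_gt0).
have L'0 : 0 <= L'.
  by rewrite addr_ge0 // divr_ge0 ?(ltW lambda_gt0) // addr_ge0 // divr_ge0 ?sqr_ge0.
pose c1 := 1 + K * L; pose c2 := 1 + L' / alphab * (1 + `|CW|).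
have c1_ge1 : 1 <= c1 by rewrite /c1 lerDl mulr_ge0.
have c2_ge1 : 1 <= c2.
  by rewrite /c2 lerDl mulr_ge0 ?addr_ge0 // divr_ge0 ?(ltW alphab_gt0).
exists (c1 + c2); split; first lra.
move=> X M W Q i _ E _ Qad _ _ _ f ud a b _ _ _ _ _ _.
move=> Xh fXh normh [n0 _ _ nD] _ Mh fMh Qh _ Qadh QadhQad QadhQh _ _ _.
move=> ah blah bh blbh _ _ ell _ Eh lEh EhE hCW hEh Pih oPih PihQ.
move=> u phi p r y Qy _ _ _ _ vi uh phih ph rh yh Suh Sphih Sph Srh Qyh.
move=> su ku sphi kphi vih Phu Pb Rhp Rbhr SPhu SPb SRhp SRbhr sPu kPu sPb kPb.
have Xh0 := fin_dim_subspace0 fXh.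
have XhS z : Xh z -> sum_space i Xh z.
  by move=> Sz; exists 0 => //; exists z => //; rewrite linear0 add0r.
have iXS v z : Xh z -> sum_space i Xh (i v - z).
  move=> Sz; exists v => //; exists (- z) => //.
  by rewrite -sub0r; exact: fin_dim_subspaceB.
have iS v : sum_space i Xh (i v).
  by rewrite -(subr0 (i v)); exact: iXS.
pose d := Phu - uh; pose e := Pb - phih.
have Sd : Xh d by exact: fin_dim_subspaceB.
have Se : Xh e by exact: fin_dim_subspaceB.
have kd : form_kernel Xh Mh bh d.
  split=> // w Mw; rewrite (bilinear_onBl blbh) //.
  by rewrite kPu // ku // subr0.
have ke : form_kernel Xh Mh bh e.
  split=> // w Mw; rewrite (bilinear_onBl blbh) //.
  by rewrite kPb // kphi // subr0.
(* The data [f] and [ud] cancel in the differences of projection and discrete equations. *)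
have [dual add aee] : [/\ '[y - yh, Eh e] = '[i u - uh, d],
    ah d d = '[y - yh, Eh d] & ah e e = '[i u - uh, e]].
  apply: (saddle_duality (F := fun z => '[y - yh, Eh z]) kd ke
    (fin_dim_subspaceB fMh SRhp Sph) (fin_dim_subspaceB fMh SRbhr Srh)) => z Sz.
  - rewrite (bilinear_onBl blah) // (bilinear_onBr blbh) //.
    by move: (su z Sz) (sPu z Sz); rewrite !innerE; lra.
  - rewrite (bilinear_onBr blah) // (bilinear_onBr blbh) //.
    by move: (sphi z Sz) (sPb z Sz); rewrite !innerE; lra.
(* Assumption (II) with [v = 0] and [v_h = - z]. *)
have Eh_le z : Xh z -> `|Eh z| <= normh z.
  move=> Sz; have := hEh 0 (- z); rewrite linear0 sub0r opprK; apply.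
  by rewrite -sub0r; exact: fin_dim_subspaceB.
have W_le z : sum_space i Xh z -> `|z| <= `|CW| * normh z.
  move=> Sz; apply: le_trans (hCW _ Sz) _.
  by rewrite ler_wpM2r ?n0 // ler_norm.
set s := `|y - yh|; set t := `|i u - uh|.
have de : normh d <= s / alphab.
  apply: ler_elliptic; rewrite ?n0 ?normr_ge0 //; first exact: XhS.
  apply: le_trans (ell _ kd) _; rewrite add.
  apply: le_trans (inner_le_norm _ _) _.
  by rewrite ler_wpM2l // Eh_le.
have ee : normh e <= K * t.
  have -> : K * t = `|CW| * t / alphab by rewrite /K; ring.
  apply: ler_elliptic; rewrite ?mulr_ge0 ?normr_ge0 ?n0 //; first exact: XhS.
  apply: le_trans (ell _ ke) _; rewrite aee.
  apply: le_trans (inner_le_norm _ _) _.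
  by rewrite -mulrA mulrCA ler_wpM2l // W_le //; exact: XhS.
have gb_le : `|E phi - Eh Pb| <= normh (i phi - Pb).
  rewrite -EhE -(linear_onB lEh) ?hEh //; exact: XhS.
(* The discrete gradient [Eh phih] is split as [Eh Pb - Eh e], separating the projection error from
   the term handled by duality. *)
have energy := control_error (lambda := lambda) (y := y) (g := E phi)
  (gb := Eh Pb) (e := Eh e) oPih (QadhQh _ Qyh) (vi _ (QadhQad _ Qyh)).
have {}energy := energy _.
have ehE : Eh Pb - Eh e = Eh phih.
  by rewrite -(linear_onB lEh) ?subKr //; exact: XhS.
rewrite ehE in energy.
have {}energy := energy (vih _ (PihQ _ Qy)).
set A := normh (i phi - Pb); set G := `|E phi - Pih (E phi)|.
set B := `|y - Pih y|; set D := `|i u - Phu|.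
have A0 : 0 <= A by rewrite n0 //; exact: iXS.
have [G0 B0 D0] : [/\ 0 <= G, 0 <= B & 0 <= D] by split; exact: normr_ge0.
have [s0 t0] : 0 <= s /\ 0 <= t by split; exact: normr_ge0.
have U0 : 0 <= normh (i u - Phu) by rewrite n0 //; exact: iXS.
(* Writing [d = (i u - uh) - (i u - Phu)] in [dual] produces the square [t ^+ 2]. *)
have dualE : '[y - yh, Eh e] >= t ^+ 2 - t * D.
  have -> : '[y - yh, Eh e] = t ^+ 2 - '[i u - uh, i u - Phu].
    by rewrite dual -inner_normE !innerE; lra.
  by rewrite lerD2l lerN2 inner_le_norm.
have [tL sL] : t <= L * (A + G + B + D) /\ s <= L' * (A + G + B + D).
  apply: (coupled_bounds lambda_gt0 K0 A0 B0 G0 D0 s0 t0 ee).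
  have e1 : `|E phi - Eh Pb| * s <= A * s by rewrite ler_wpM2r.
  have e2 : (`|E phi - Eh Pb| + `|Eh e| + G) * B <= (A + normh e + G) * B.
    by rewrite ler_wpM2r // lerD2r lerD // Eh_le.
  by move: energy; rewrite -/s -/G -/B; lra.
split.
- have -> : i phi - phih = (i phi - Pb) + e by rewrite /e addrA subrK.
  apply: le_trans (nD _ _ (iXS _ _ SPb) (XhS _ Se)) _.
  have : normh e <= K * L * (A + G + B + D).
    by apply: le_trans ee _; rewrite -mulrA ler_wpM2l.
  have : 0 <= (c2 - 1) * (A + G + B + D) by rewrite mulr_ge0 ?subr_ge0 ?addr_ge0.
  by rewrite -/A /c1 !mulrDl; lra.
- have -> : i u - uh = (i u - Phu) + d by rewrite /d addrA subrK.
  apply: le_trans (nD _ _ (iXS _ _ SPhu) (XhS _ Sd)) _.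
  set Y := normh (i u - Phu) in U0 *.
  (* The second estimate has no [W]-norm term: (I) trades [D] for [Y], whence the factor [1 + |CW|]
     in [c2]. *)
  have DY : D <= `|CW| * Y by apply: W_le; exact: iXS.
  have TY : A + G + B + D <= (1 + `|CW|) * (Y + A + G + B).
    have : 0 <= `|CW| * (A + G + B) by rewrite mulr_ge0 ?addr_ge0.
    by rewrite mulrDl mul1r !mulrDr; lra.
  have : normh d <= L' / alphab * (1 + `|CW|) * (Y + A + G + B).
    apply: (le_trans de).
    have -> : L' / alphab * (1 + `|CW|) * (Y + A + G + B) =
      L' * ((1 + `|CW|) * (Y + A + G + B)) / alphab by ring.
    rewrite ler_pM2r ?invr_gt0 //; apply: le_trans sL _.
    by rewrite ler_wpM2l.
  have : 0 <= c1 * (Y + A + G + B).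
    by rewrite mulr_ge0 ?(le_trans ler01 c1_ge1) ?addr_ge0.
  by rewrite /c2 !mulrDl; lra.
Qed.
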